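(* Let $A$ and $B$ be $C^*$-algebras, let $n \geq 3$ be an odd integer, and let $\phi : A \to B$ be an involutive $n$-homomorphism. Then $\|\phi\| \leq 1$, i.e. $\|\phi(a)\| \leq \|a\|$ for all $a \in A$.
   Context: An $n$-homomorphism between algebras $A$ and $B$ is a linear map $\phi : A \to B$ with $\phi(a_1 a_2 \cdots a_n) = \phi(a_1)\phi(a_2)\cdots\phi(a_n)$ for all $a_1,\dots,a_n \in A$. It is involutive if $\phi(a^* ) = \phi(a)^*$ for all $a \in A$. The $C^*$-algebras are not assumed unital and $\phi$ is not assumed continuous. *)

(* Defs.v *)
From HB Require Import structures.
From mathcomp Require Import all_boot all_order all_algebra.
From mathcomp Require Import complex.
From mathcomp Require Import boolp classical_sets reals topology normedtype.

Set Implicit Arguments.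
Unset Strict Implicit.
Unset Printing Implicit Defensive.

Import Order.TTheory GRing.Theory Num.Theory.

Local Open Scope ring_scope.

(* Associative algebras, not assumed unital; since the ring structures of the
   library all have a unit, the product is the semigroup law ( _ * _ )%g.     *)
HB.mixin Record Lmodule_Semigroup_isNuAlgebra (K : pzRingType) A
    of GRing.Lmodule K A & Semigroup A := {
  nuMDl : forall x y z : A, ((x + y)%R * z)%g = (x * z)%g + (y * z)%g;
  nuMDr : forall x y z : A, (x * (y + z)%R)%g = (x * y)%g + (x * z)%g;
  nuZMl : forall (k : K) (x y : A), ((k *: x)%R * y)%g = k *: (x * y)%g;
  nuZMr : forall (k : K) (x y : A), (x * (k *: y)%R)%g = k *: (x * y)%g
}.

#[short(type="nuAlgType")]
HB.structure Definition NuAlgebra (K : pzRingType) :=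
  { A of Lmodule_Semigroup_isNuAlgebra K A & GRing.Lmodule K A & Semigroup A }.

(* The norm takes its values in R[i]; it is real since 0 <= `|x| there. *)
HB.mixin Record NuAlgebra_isCStarAlgebra (R : realType) A
    of CompleteNormedModule R[i] A & NuAlgebra R[i] A := {
  star : A -> A;
  starK : involutive star;
  starD : {morph star : x y / x + y};
  starZ : forall (k : R[i]) (x : A), star (k *: x) = (k^*)%R *: star x;
  starM : forall x y : A, star (x * y)%g = (star y * star x)%g;
  normM_le : forall x y : A, `|(x * y)%g| <= `|x| * `|y|;
  norm_starM : forall x : A, `|(star x * x)%g| = `|x| ^+ 2
}.

#[short(type="cstarAlgType")]
HB.structure Definition CStarAlgebra (R : realType) :=
  { A of NuAlgebra_isCStarAlgebra R A & CompleteNormedModule R[i] A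
       & NuAlgebra R[i] A }.

(* The product x * a_1 * ... * a_k of the nonempty sequence x :: a. *)
Definition mulseq (A : semigroupType) (x : A) (a : seq A) : A :=
  foldl (fun y z => (y * z)%g) x a.

Definition n_homomorphism (K : pzRingType) (A B : nuAlgType K) (n : nat)
    (phi : {linear A -> B}) : Prop :=
  forall (x : A) (a : seq A), size (x :: a) = n ->
    phi (mulseq x a) = mulseq (phi x) (map phi a).

Definition involutive_map (R : realType) (A B : cstarAlgType R)
    (phi : A -> B) : Prop :=
  forall a : A, phi (star a) = star (phi a).

(* Main.v *)
(* By homogeneity it is enough to exclude [`|x| < 1] and [`|phi x| = 1].  Let
   n = 2k + 1 and p = phi(x)^* phi(x), so that [`|p| = 1].  By completeness
   there is c with c = x + c (x^* x)^(2k), and then u = phi(x)^* phi(c)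
   satisfies u = p + u p^(2k), although phi need not be continuous.  Unfolding
   this N times, sum_(j < N) p^(2kj + 1) = u - u p^(2kN) has norm at most
   [2 * `|u|].  For N = 2^M the sum is p prod_(i < M) (1 + e_i^2) with
   e_i = p^(k 2^i), and the C*-version [2 * `|e z| <= `|z + e^2 z|] of
   2 t <= 1 + t^2, for commuting self-adjoint e and z, bounds its norm below by
   2^M times the norm of a power of p, that is by 2^M, which is absurd. *)
Require Import Defs.
From mathcomp Require Import all_boot all_order all_algebra.
From mathcomp Require Import complex.
From mathcomp Require Import boolp classical_sets reals topology normedtype.
From mathcomp Require Import ring zify.

Set Implicit Arguments.
Unset Strict Implicit.
Unset Printing Implicit Defensive.

Import Order.TTheory GRing.Theory Num.Theory.
Local Open Scope ring_scope.

(** * Products and powers in a semigroup *)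

Section MulSeq.
Variables (A : semigroupType).
Implicit Types (x y : A) (a : seq A).

Lemma mulgseq x y a : (x * mulseq y a)%g = mulseq x (y :: a).
Proof. by rewrite /mulseq; elim: a y => //= z a IHa y; rewrite IHa mulgA. Qed.

Lemma mulseq_cat x a b : mulseq x (a ++ b) = mulseq (mulseq x a) b.
Proof. exact: foldl_cat. Qed.

Lemma mulseq_flatten2 x y z m :
  mulseq x (flatten (nseq m [:: y; z])) = mulseq x (nseq m (y * z)%g).
Proof. by elim: m x => //= m IHm x; rewrite -mulgA IHm. Qed.

(* The power x^(m+1): a semigroup has no zeroth power. *)
Definition gpow x m := mulseq x (nseq m x).

Lemma mulseq_nseqS x y m : mulseq x (nseq m.+1 y) = (x * gpow y m)%g.
Proof. by rewrite mulgseq. Qed.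

Lemma gpow_mul x i j : (gpow x i * gpow x j)%g = gpow x (i + j).+1.
Proof.
by rewrite mulgseq -mulseq_cat -(nseqD i j.+1) addnS.
Qed.

End MulSeq.

(** * Norm estimates for self-adjoint elements *)

Section CStar.
Variables (R : realType) (A : cstarAlgType R).
Implicit Types x y z e p q : A.

Lemma nuMNl x y : ((- x)%R * y)%g = - (x * y)%g.
Proof. by rewrite -scaleN1r nuZMl scaleN1r. Qed.

Lemma nuMNr x y : (x * (- y)%R)%g = - (x * y)%g.
Proof. by rewrite -scaleN1r nuZMr scaleN1r. Qed.

Lemma nuMBl x y z : ((x - y)%R * z)%g = (x * z)%g - (y * z)%g.
Proof. by rewrite nuMDl nuMNl. Qed.

Lemma nuMBr x y z : (z * (x - y)%R)%g = (z * x)%g - (z * y)%g.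
Proof. by rewrite nuMDr nuMNr. Qed.

Lemma nuM0l x : ((0 : A)%R * x)%g = 0.
Proof. by rewrite -(scale0r (0 : A)) nuZMl !scale0r. Qed.

Lemma nuM0r x : (x * (0 : A)%R)%g = 0.
Proof. by rewrite -(scale0r (0 : A)) nuZMr !scale0r. Qed.

Lemma nuM_suml I (r : seq I) (F : I -> A) y :
  ((\sum_(i <- r) F i)%R * y)%g = \sum_(i <- r) (F i * y)%g.
Proof. by elim/big_rec2: _ => [|i u v _ <-]; rewrite ?nuM0l ?nuMDl. Qed.

Lemma nuM_sumr I (r : seq I) (F : I -> A) y :
  (y * (\sum_(i <- r) F i)%R)%g = \sum_(i <- r) (y * F i)%g.
Proof. by elim/big_rec2: _ => [|i u v _ <-]; rewrite ?nuM0r ?nuMDr. Qed.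

Lemma starN x : star (- x) = - star x.
Proof. by rewrite -scaleN1r starZ rmorphN1 scaleN1r. Qed.

Lemma star0 : star (0 : A) = 0.
Proof. by rewrite -(scale0r (0 : A)) starZ rmorph0 !scale0r. Qed.

Lemma star_sum I (r : seq I) (F : I -> A) :
  star (\sum_(i <- r) F i) = \sum_(i <- r) star (F i).
Proof. by elim/big_rec2: _ => [|i u v _ <-]; rewrite ?star0 ?starD. Qed.

(** The C*-identity gives [|y|^2 <= |star y| |y|]; cancel [|y|], then take [star x] for [y]. *)
Lemma norm_star x : `|star x| = `|x|.
Proof.
have le_star y : `|y| <= `|star y|.
  have [->|y0] := eqVneq y 0; first by rewrite normr0.
  by rewrite -(ler_pM2r (_ : 0 < `|y|)) ?normr_gt0// -expr2 -norm_starM normM_le.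
by apply/le_anti; rewrite le_star -{2}(starK x) le_star.
Qed.

Lemma norm_selfadj_sqr x : star x = x -> `|(x * x)%g| = `|x| ^+ 2.
Proof. by move=> sx; rewrite -{1}sx norm_starM. Qed.

(** For [w = x + i y] the right side is the norm of [w^* w], that is [|w|^2], and [y] is the
    imaginary part of [w], so [|y| <= |w|]. *)
Lemma norm_sum_sqr_ge x y : star x = x -> star y = y -> (x * y = y * x)%g ->
  `|y| ^+ 2 <= `|(x * x)%g + (y * y)%g|.
Proof.
move=> sx sy xy; pose w := x + 'i *: y.
have sw : star w = x - 'i *: y by rewrite starD starZ sx sy conjCi scaleNr.
have wwE : (star w * w)%g = (x * x)%g + (y * y)%g.
  rewrite sw nuMBl !nuMDr !nuZMl !nuZMr scalerA -expr2 sqrCi xy scaleN1r.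
  by rewrite opprD opprK -addrA addNKr.
have yE : (2 * 'i) *: y = w - star w.
  by rewrite sw opprB [_ - x]addrC addrACA subrr add0r -scalerDl mulr_natl mulr2n.
rewrite -wwE norm_starM ler_sqr ?nnegrE//.
rewrite -(ler_pM2l (_ : 0 < 2)) ?ltr0n//.
rewrite (_ : 2 * `|y| = `|(2 * 'i) *: y|); last first.
  by rewrite normrZ normrM normCi mulr1 ger0_norm ?ler0n.
by rewrite yE (le_trans (ler_normB _ _))// norm_star mulr_natl.
Qed.

(* [(z - e^2 z)^2 + (2 e z)^2 = (z + e^2 z)^2] *)
Lemma norm_AMGM e z : star e = e -> star z = z -> (e * z = z * e)%g ->
  2 * `|(e * z)%g| <= `|z + (e * (e * z))%g|.
Proof.
move=> se sz ez; pose s := (e * z)%g; rewrite -/s; pose t := (e * s)%g; rewrite -/t.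
have ss : star s = s by rewrite /s starM se sz.
have es : (e * s = s * e)%g by rewrite /s -mulgA -ez.
have st : star t = t by rewrite /t starM se ss es.
have zs : (z * s = s * z)%g by rewrite /s mulgA -ez.
have zt : (z * t = t * z)%g by rewrite /t mulgA -ez -[LHS]mulgA zs mulgA.
have ts : (t * s = s * t)%g by rewrite /t [in RHS]mulgA -es.
have ssE : (s * s = z * t)%g by rewrite /t [in RHS]mulgA -ez.
have sqE : ((z - t)%R * (z - t)%R)%g + ((2 *: s)%R * (2 *: s)%R)%g
    = ((z + t)%R * (z + t)%R)%g.
  rewrite nuMBl !nuMBr nuZMl nuZMr ssE nuMDl !nuMDr -zt scalerA -natrM.
  rewrite scaler_nat (mulrnA _ 2 2) !mulr2n opprB (addrACA (z * z)%g) -opprD.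
  by rewrite subrKA addrACA (addrC (t * t)%g).
have := @norm_sum_sqr_ge (z - t) (2 *: s).
rewrite sqE norm_selfadj_sqr ?starD ?sz ?st// normrZ ger0_norm//.
rewrite ler_sqr ?nnegrE ?mulr_ge0//; apply=> //.
- by rewrite starN st.
- by rewrite starZ ss conjC_nat.
- by rewrite nuMBl nuMBr !nuZMl !nuZMr -zs ts.
Qed.

Lemma gpow_selfadj p m : star p = p -> star (gpow p m) = gpow p m.
Proof.
move=> sp; elim: m => [|m IHm] //.
rewrite -[in LHS](gpow_mul p 0 m) starM IHm [star (gpow p 0)]sp.
by rewrite (gpow_mul p m 0) addn0.
Qed.

Lemma norm_mulseq_nseq_le x p m : `|p| <= 1 -> `|mulseq x (nseq m p)| <= `|x|.
Proof.
move=> p1; elim: m x => //= m IHm x; apply: (le_trans (IHm _)).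
by rewrite (le_trans (normM_le _ _))// ler_piMr.
Qed.

(** Repeated squaring gives [p^(2^i)] norm 1. Some such power is [p^(m+1)] times further factors of
    norm 1, which cannot increase the norm. *)
Lemma norm_gpow_ge1 p m : star p = p -> `|p| = 1 -> 1 <= `|gpow p m|.
Proof.
move=> sp p1; have pow2 i : `|gpow p (2 ^ i).-1| = 1.
  elim: i => [//|i IHi].
  have -> : (2 ^ i.+1).-1 = ((2 ^ i).-1 + (2 ^ i).-1).+1.
    by have := expn_gt0 2 i; rewrite expnS; lia.
  by rewrite -gpow_mul norm_selfadj_sqr ?gpow_selfadj// IHi expr1n.
have /subnKC mE : (m <= (2 ^ m).-1)%N by have := ltn_expl m (isT : (1 < 2)%N); lia.
by rewrite -(pow2 m) -mE /gpow nseqD mulseq_cat norm_mulseq_nseq_le ?p1.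
Qed.

(** Induction on [M]: the upper half of the sum is [e^2] times the lower half [z], with
    [e = p^(k 2^M)]. [norm_AMGM] then gains a factor 2 and replaces [z] by [e z], which raises [r]
    by [k 2^M]; these shifts add up to [k (2^M - 1)]. *)
Lemma norm_sum_gpow_ge p k r M : star p = p -> (0 < k)%N ->
  2 ^+ M * `|gpow p (k * (2 ^ M).-1 + r)|
    <= `|\sum_(0 <= j < 2 ^ M) gpow p (2 * k * j + r)|.
Proof.
move=> sp k0; elim: M r => [|M IHM] r.
  by rewrite big_nat1 !muln0 expr0 mul1r.
have kM0 : (0 < k * 2 ^ M)%N by rewrite muln_gt0 k0 expn_gt0.
pose e := gpow p (k * 2 ^ M).-1.
pose z r := \sum_(0 <= j < 2 ^ M) gpow p (2 * k * j + r).
have ezE r' : (e * z r')%g = z (r' + k * 2 ^ M)%N.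
  rewrite nuM_sumr; apply: eq_bigr => j _; rewrite gpow_mul; congr gpow; lia.
have zeE r' : (z r' * e)%g = z (r' + k * 2 ^ M)%N.
  rewrite nuM_suml; apply: eq_bigr => j _; rewrite gpow_mul; congr gpow; lia.
have -> : \sum_(0 <= j < 2 ^ M.+1) gpow p (2 * k * j + r)
    = z r + (e * (e * z r))%g.
  rewrite !ezE (big_cat_nat (n := (2 ^ M)%N)) ?leq_exp2l//=; congr (_ + _).
  rewrite -{1}[(2 ^ M)%N]add0n big_addn expnS mul2n -addnn addnK.
  by apply: eq_bigr => j _; congr gpow; lia.
apply: le_trans (norm_AMGM _ _ _); last 3 first.
- exact: gpow_selfadj.
- by rewrite star_sum; apply: eq_bigr => j _; rewrite gpow_selfadj.
- by rewrite ezE zeE.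
rewrite ezE exprS -mulrA ler_wpM2l// (le_trans _ (IHM _))//.
rewrite [X in _ * `|gpow p X| <= _](_ : _ = k * (2 ^ M).-1 + (r + k * 2 ^ M))%N//.
by rewrite expnS; have := expn_gt0 2 M; nia.
Qed.

Lemma mulseqD x y (a : seq A) : mulseq (x + y) a = mulseq x a + mulseq y a.
Proof. by rewrite /mulseq; elim: a x y => //= z a IHa x y; rewrite nuMDl. Qed.

Lemma sum_gpow_telescope u p d N : u = p + mulseq u (nseq d p) ->
  u = \sum_(0 <= j < N) gpow p (d * j) + mulseq u (nseq (d * N) p).
Proof.
move=> uE; elim: N => [|N IHN]; first by rewrite big_geq// muln0 add0r.
rewrite big_nat_recr//= -addrA mulnS nseqD mulseq_cat /gpow -mulseqD -uE.
exact: IHN.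
Qed.

End CStar.

(** * Geometric decay and the equation [c = x + c q] *)

Lemma complex_archi (R : realType) (x : R[i]) : 0 <= x -> exists m, x < m%:R.
Proof.
move=> x0; exists (Num.Def.archi_bound (complex.Re x)).
have xE : x = (complex.Re x)%:C%C by rewrite RRe_real ?ger0_real.
rewrite {1}xE -(rmorph_nat (real_complex R)) ltcR archi_boundP//.
by rewrite -ler0c -xE.
Qed.

Lemma expr_bernoulli (K : numDomainType) (r : K) m : 0 <= r <= 1 ->
  r ^+ m * (m%:R * (1 - r)) <= 1.
Proof.
(* With the extra summand 1 the left side decreases in [m]. *)
move=> /andP[r0 r1]; suff: r ^+ m * (1 + m%:R * (1 - r)) <= 1.
  by apply: le_trans; rewrite ler_wpM2l ?exprn_ge0// lerDr ler01.
elim: m => [|m IHm]; first by rewrite mul0r addr0 mulr1.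
apply: le_trans IHm; rewrite exprS (mulrC r) -mulrA ler_wpM2l ?exprn_ge0//.
rewrite -subr_ge0 [leRHS](_ : _ = m.+1%:R * (1 - r) ^+ 2).
  by rewrite mulr_ge0// exprn_ge0 ?subr_ge0.
by rewrite -natr1; ring.
Qed.

Lemma geometric_small (R : realType) (r b e : R[i]) : 0 <= r < 1 -> 0 <= b -> 0 < e ->
  exists m, r ^+ m * b < e.
Proof.
move=> /andP[r0 r1] b0 e0.
have d0 : 0 < 1 - r by rewrite subr_gt0.
have [|m bm] := @complex_archi _ (b / (e * (1 - r))).
  by rewrite divr_ge0// mulr_ge0// ltW.
exists m; have [rm0|rm0] := eqVneq (r ^+ m) 0; first by rewrite rm0 mul0r.
have rmp : 0 < r ^+ m by rewrite lt0r rm0 exprn_ge0.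
have := @expr_bernoulli _ r m; rewrite r0 ltW// => /(_ isT) H.
move: bm; rewrite ltr_pdivrMr ?mulr_gt0// => bm.
rewrite (lt_le_trans (_ : _ < r ^+ m * (m%:R * (e * (1 - r)))))// ?ltr_pM2l//.
by rewrite (mulrCA m%:R) (mulrCA (r ^+ m)) -[leRHS]mulr1 ler_pM2l.
Qed.

(** The map [f] contracts distances by the factor [|q|], so its iterates from [x], the partial sums
    of [x + x q + x q^2 + ...], converge to a fixed point. *)
Lemma eq_add_mulr_solvable (R : realType) (A : cstarAlgType R) (x q : A) :
  `|q| < 1 -> exists c : A, c = x + (c * q)%g.
Proof.
move=> q1; pose f c := x + (c * q)%g; pose c_ m := iter m f x.
have fB y z : `|f y - f z| <= `|y - z| * `|q|.
  by rewrite opprD addrACA subrr add0r -nuMBl normM_le.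
(* The sum of the series of the [|x| |q|^i], which bounds every iterate. *)
pose K := `|x| / (1 - `|q|).
have d0 : 0 < 1 - `|q| by rewrite subr_gt0.
have xE : `|x| = K * (1 - `|q|) by rewrite mulfVK ?gt_eqF.
have K0 : 0 <= K by rewrite divr_ge0// ltW.
have c_le m : `|c_ m| <= K.
  elim: m => [|m IHm]; first by rewrite /= xE ler_piMr// gerBl.
  rewrite (le_trans (ler_normD _ _))//.
  have := le_trans (normM_le (c_ m) q) (ler_wpM2r (normr_ge0 q) IHm).
  by move=> H; rewrite (le_trans (lerD (lexx _) H))// xE mulrBr mulr1 subrK.
have c_dist m i : `|c_ (m + i)%N - c_ m| <= `|q| ^+ m * (K + K).
  elim: m => [|m IHm].
    by rewrite expr0 mul1r (le_trans (ler_normB _ _))// lerD.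
  by rewrite (le_trans (fB _ _))// exprS -mulrA mulrC ler_wpM2l.
have /cvg_ex[/= c c_c] : cvg (c_ @ \oo)%classic.
  apply: cauchy_cvg; apply: cauchy_exP => e e0.
  have [||m me] := geometric_small _ _ e0 (r := `|q|) (b := K + K).
  - by rewrite normr_ge0.
  - exact: addr_ge0.
  exists (c_ m), m => // j /= mj; rewrite -ball_normE /= distrC.
  by rewrite -(subnKC mj) (le_lt_trans (c_dist _ _)).
(* Otherwise take [m] with [c_ m] and [c_ m.+1 = f (c_ m)] both closer to [c] than half of
   [|c - f c|]. *)
exists c; apply/eqP; rewrite -subr_eq0; apply/negPn; rewrite -normr_gt0; apply/negP => e0.
move/cvgrPdist_lt : c_c => /(_ _ (divr_gt0 e0 (ltr0n _ 2)))[m _ mP].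
have := ltrD (mP m.+1 (leqnSn m)) (mP m (leqnn m)); rewrite -splitr.
apply/negP; rewrite -real_leNgt ?realD ?normr_real//.
rewrite -/(f c) -(subrKA (c_ m.+1)) (le_trans (ler_normD _ _))// lerD2l.
by rewrite (le_trans (fB (c_ m) c))// distrC ler_piMr// ltW.
Qed.

(** * The bound for involutive n-homomorphisms *)

Section NHomomorphism.
Variables (R : realType) (A B : cstarAlgType R) (k : nat) (phi : {linear A -> B}).
Hypotheses (k0 : (0 < k)%N) (hphi : n_homomorphism k.*2.+1 phi).
Hypothesis hinv : involutive_map phi.

(** Here the oddness of [n] enters: [y (x^* x)^k] has exactly [2k + 1] factors, so [phi] splits it;
    repeat [m] times. *)
Lemma n_homomorphism_star_pow y x m :
  phi (mulseq y (nseq (m * k) (star x * x)%g))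
  = mulseq (phi y) (nseq (m * k) (star (phi x) * phi x)%g).
Proof.
elim: m y => [//|m IHm] y.
rewrite mulSn !nseqD !mulseq_cat IHm -!mulseq_flatten2 hphi.
  by rewrite map_flatten map_nseq /= hinv.
by rewrite /= size_flatten /shape map_nseq sumn_nseq mul2n.
Qed.

Lemma n_homomorphism_norm_neq1 x : `|x| < 1 -> `|phi x| <> 1.
Proof.
(* This is [(x^* x)^(2k)], as [gpow] counts from exponent 1. *)
move=> x1 phix1; pose q := gpow (star x * x)%g (2 * k).-1.
have kE : (2 * k).-1.+1 = (2 * k)%N by lia.
have q1 : `|q| < 1.
  apply: (@le_lt_trans _ _ `|(star x * x)%g|); last by rewrite norm_starM expr_lt1.
  by rewrite norm_mulseq_nseq_le// norm_starM expr_le1// ltW.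
have [c cE] := eq_add_mulr_solvable x q1.
pose p := (star (phi x) * phi x)%g.
have p1 : `|p| = 1 by rewrite norm_starM phix1 expr1n.
have sp : star p = p by rewrite starM starK.
pose u := (star (phi x) * phi c)%g.
have uE : u = p + mulseq u (nseq (2 * k) p).
  (* Apply [phi] to the equation for [c], with [m = 2] blocks, and multiply on the left by
     [phi(x)^*]. *)
  rewrite {1}/u {1}cE -mulseq_nseqS kE linearD n_homomorphism_star_pow nuMDr.
  by rewrite mulgseq.
have uM M : 2 ^+ M <= 2 * `|u|.
  have := norm_sum_gpow_ge 0 M sp k0; under eq_bigr do rewrite addn0.
  have /eqP := sum_gpow_telescope (2 ^ M) uE; rewrite -subr_eq => /eqP <-.
  move=> H; apply: (le_trans _ (le_trans H _)).
    by rewrite ler_peMr ?exprn_ge0 ?norm_gpow_ge1.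
  rewrite (le_trans (ler_normB _ _))// mulr_natl mulr2n lerD2l.
  by rewrite norm_mulseq_nseq_le ?p1.
(* Such an [M] gives [2 |u| < M < 2^M], against [uM]. *)
have [|M] := @complex_archi _ (2 * `|u|); first by rewrite mulr_ge0.
apply/negP; rewrite -real_leNgt ?realM ?normr_real ?realn//.
by rewrite (le_trans _ (uM M))// -natrX ler_nat ltnW// ltn_expl.
Qed.

End NHomomorphism.

Theorem theorem3p2 (R : realType) (A B : cstarAlgType R) (n : nat)
    (hn3 : (3 <= n)%N) (hn_odd : odd n) (phi : {linear A -> B})
    (hphi : n_homomorphism n phi) (hinv : involutive_map phi) :
  forall a : A, `|phi a| <= `|a|.
Proof.
move=> a; rewrite real_leNgt ?normr_real//; apply/negP => lt_a.
have nE : n = n./2.*2.+1 by rewrite -[LHS]odd_double_half hn_odd.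
have k0 : (0 < n./2)%N by rewrite half_gt0 ltnW.
rewrite nE in hphi; have b0 : 0 < `|phi a| by apply: le_lt_trans lt_a.
have := @n_homomorphism_norm_neq1 _ _ _ _ _ k0 hphi hinv (`|phi a|^-1 *: a).
rewrite linearZ !normrZ normfV normr_id mulVf ?gt_eqF//; apply=> //.
by rewrite mulrC ltr_pdivrMr// mul1r.
Qed.
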